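(* Consider the reset-button coupon collector described in the context, with arbitrary standard coupon probabilities. For each $n$, let $0<\rho_n<1$, $q_n=1-\rho_n$, let $C_n$ be the ordinary coupon collector completion time with probabilities $\pi_{i,n}=p_{i,n}/q_n$ (a positive integer-valued random variable) with probability generating function $\phi_n(z)=\mathbb E z^{C_n}$, and define $s_n:=\phi_n(q_n)=\mathbb E q_n^{C_n}$. Assume $s_n\to0$ and $\rho_nq_n\phi_n'(q_n)\to0$. Then $\rho_ns_nT_n\Rightarrow\mathrm{Exp}(1)$, and for every fixed integer $r\ge1$, $\mathbb E(\rho_ns_nT_n)^r\to r!$.
   Context: Reset-button collector: fix $n\ge1$. There are standard coupons $1,\dots,n$ and a reset coupon. At each discrete time $t=1,2,\dots$ one coupon is sampled independently: the reset coupon with probability $\rho_n\in(0,1)$, standard coupon $i$ with probability $p_{i,n}>0$, where $\sum_{i=1}^np_{i,n}=q_n:=1-\rho_n$. Starting from the empty collection, a standard coupon drawn is added to the collection; when the reset coupon appears the collection is emptied and collecting continues from the empty collection. $T_n$ is the first time at which all $n$ standard coupons are present. The ordinary coupon collector completion time $C_n$ with probabilities $\pi_{1,n},\dots,\pi_{n,n}$ is the number of i.i.d. draws from $[n]$ with these probabilities needed until every type has been seen. $\mathrm{Exp}(1)$ is the exponential law with mean 1. *)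

(* Defs.v *)
From HB Require Import structures.
From mathcomp Require Import all_boot all_order all_algebra.
From mathcomp Require Import all_classical all_reals all_analysis.
Set Implicit Arguments. Unset Strict Implicit. Unset Printing Implicit Defensive.
Import Order.TTheory GRing.Theory Num.Theory.
Import numFieldNormedType.Exports.
Local Open Scope ring_scope.

Section CouponDefs.
Variable R : realType.

(* Law of the first time the collection (a subset of 'I_n, starting empty and
   updated by [step] at each i.i.d. draw with weights [wt]) equals the full set:
   P(first hitting time = t) = sum over draw sequences of length t that reach
   the full set at step t and not before, of the product of the weights. *)
Definition hit_law (D : finType) (n : nat) (wt : D -> R)
  (step : {set 'I_n} -> D -> {set 'I_n}) (t : nat) : R :=
  \sum_(w : t.-tuple D |
        [forall k : 'I_t, foldl step finset.set0 (take k w) != (finset.setTfor 'I_n)]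
        && (foldl step finset.set0 w == (finset.setTfor 'I_n)))
     \prod_(d <- w) wt d.

Definition reset_wt (n : nat) (rho : R) (p : 'I_n -> R) (d : option 'I_n) : R :=
  match d with None => rho | Some i => p i end.
Definition reset_step (n : nat) (S : {set 'I_n}) (d : option 'I_n) : {set 'I_n} :=
  match d with None => finset.set0 | Some i => i |: S end.

Definition T_law (n : nat) (rho : R) (p : 'I_n -> R) (t : nat) : R :=
  hit_law (reset_wt rho p) (@reset_step n) t.

Definition C_law (n : nat) (pi : 'I_n -> R) (t : nat) : R :=
  hit_law pi (fun S (i : 'I_n) => i |: S) t.

Definition coupon_pi (n : nat) (rho : R) (p : 'I_n -> R) : 'I_n -> R :=
  fun i => p i / (1 - rho).

(* phi(z) = E z^C = sum_t P(C=t) z^t  (nonnegative series, for z >= 0) *)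
Definition pgf (law : nat -> R) (z : R) : R :=
  fine (\sum_(0 <= t <oo) (law t * z ^+ t)%:E)%E.

Definition dpgf (law : nat -> R) (z : R) : R :=
  fine (\sum_(1 <= t <oo) (t%:R * law t * z ^+ t.-1)%:E)%E.

Definition s_of (n : nat) (rho : R) (p : 'I_n -> R) : R :=
  pgf (C_law (coupon_pi rho p)) (1 - rho).

Definition scaled_cdf (law : nat -> R) (c x : R) : R :=
  fine (\sum_(0 <= t <oo) (if c * t%:R <= x then law t else 0)%:E)%E.

Definition scaled_moment (law : nat -> R) (c : R) (r : nat) : \bar R :=
  (\sum_(0 <= t <oo) (law t * (c * t%:R) ^+ r)%:E)%E.

Definition exp1_cdf (x : R) : R := if 0 <= x then 1 - expR (- x) else 0.

End CouponDefs.

(* Main.v *)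
Require Import Defs.
From HB Require Import structures.
From mathcomp Require Import all_boot all_order all_algebra.
From mathcomp Require Import all_classical all_reals all_analysis.
From mathcomp Require Import ring lra zify.
Import Order.TTheory GRing.Theory Num.Theory.
Import numFieldNormedType.Exports.
Local Open Scope classical_set_scope.
Local Open Scope ring_scope.

(** Fix n and write q = 1 - rho, theta = rho s, G_t = P(T > t), a_t = q^t P(C = t).
    Conditioning on the last reset before completion gives
      P(T = t+1) = a_(t+1) + rho * sum_(j <= t) a_j G_(t-j).
    Summing it and using that G is nonincreasing with values in [0, 1] traps
    1 - G_t - theta * sum_(u < t) G_u between - rho m and s, where
    m = sum_j j a_j = q phi'(q); iterating this near-recursion yields
    |G_t - (1 - theta)^t| <= s + rho m uniformly in t, hence the limit law.
    For the moments, put e_r = theta^r E binom(T, r), so that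
    e_(r+1) = theta^(r+1) sum_u binom(u, r) G_u. The same identity, weighted by
    binom(t, r), and Vandermonde's formula give
      e_(r+1) <= e_r <= e_(r+1) + rho m + (r+1) s,
    because rho^i binom(k, i) q^(k-i) <= 1 controls the high moments of a.
    Thus e_r tends to 1, and r! binom(t, r) <= t^r <= r! binom(t+r, r) concludes. *)

(** * First-step recursions for hitting and survival probabilities *)

Fixpoint hit_rec {R : realType} {D : finType} {n : nat} (wt : D -> R)
    (step : {set 'I_n} -> D -> {set 'I_n}) (t : nat) (S : {set 'I_n}) : R :=
  if t is t'.+1 then
    if S == finset.setTfor 'I_n then 0
    else \sum_d wt d * hit_rec wt step t' (step S d)
  else (S == finset.setTfor 'I_n)%:R.

(** For weights of total mass 1, this is the probability that, started at [S], no collection at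
    times 0 to [t] is complete. *)
Fixpoint surv_rec {R : realType} {D : finType} {n : nat} (wt : D -> R)
    (step : {set 'I_n} -> D -> {set 'I_n}) (t : nat) (S : {set 'I_n}) : R :=
  if S == finset.setTfor 'I_n then 0
  else if t is t'.+1 then \sum_d wt d * surv_rec wt step t' (step S d) else 1.

Section FirstDraw.
Variables (R : realType) (D : finType) (n : nat) (wt : D -> R).
Variable step : {set 'I_n} -> D -> {set 'I_n}.
Local Notation full := (finset.setTfor 'I_n).

Lemma big_tuple_cons t (P : pred (t.+1.-tuple D)) (F : t.+1.-tuple D -> R) :
  \sum_(w | P w) F w =
  \sum_d \sum_(w : t.-tuple D | P [tuple of d :: w]) F [tuple of d :: w].
Proof.
rewrite pair_big_dep /=.
rewrite (reindex (fun x : D * t.-tuple D => [tuple of x.1 :: x.2])) //=.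
exists (fun w : t.+1.-tuple D => (thead w, [tuple of behead w])) => [[d w] _ | w _] /=.
- by rewrite theadE; congr (_, _); apply: val_inj.
- by rewrite [RHS]tuple_eta.
Qed.

(** The starting set is arbitrary because the first draw moves it; induction on [t] splits off that
    draw. *)
Lemma hit_recE t S : hit_rec wt step t S =
  \sum_(w : t.-tuple D |
        [forall k : 'I_t, foldl step S (take k w) != full]
        && (foldl step S w == full)) \prod_(d <- w) wt d.
Proof.
elim: t S => [|t IH] S.
- rewrite /= (eq_bigl (fun _ => S == full)); last first.
    move=> w; rewrite (tuple0 w) /=.
    have -> : [forall k : 'I_0, foldl step S (take k [::]) != full] by apply/forallP => -[].
    by [].
  case: (S == full); last by rewrite big_pred0_eq.
  rewrite (bigD1 [tuple]) //= big_nil big1 ?addr0 // => w /eqP[].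
  exact: tuple0.
- rewrite big_tuple_cons /=.
  (* Index 0 tests [S] itself; the later indices are those of the remaining word, started at
     [step S d]. *)
  have E d (w : t.-tuple D) :
      [forall k : 'I_t.+1, foldl step S (take k (d :: w)) != full] =
      (S != full) && [forall k : 'I_t, foldl step (step S d) (take k w) != full].
    apply/forallP/andP => [H | [H0 /forallP H] k].
      by split; [have := H ord0 | apply/forallP => k; have := H (lift ord0 k)].
    by case: (unliftP ord0 k) => [j|] -> //=; apply: H.
  case: (eqVneq S full) => HS.
    by rewrite big1 // => d _; apply: big_pred0 => w; rewrite E HS eqxx.
  apply: eq_bigr => d _; rewrite IH big_distrr /=.
  apply: eq_big => [w|w _]; first by rewrite E HS.
  by rewrite big_cons.
Qed.

Lemma hit_lawE t : hit_law wt step t = hit_rec wt step t finset.set0.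
Proof. by rewrite hit_recE. Qed.

Lemma hit_rec_ge0 t S : (forall d, 0 <= wt d) -> 0 <= hit_rec wt step t S.
Proof.
move=> w0; elim: t S => [|t IH] S /=; first exact: ler0n.
by case: ifP => // _; apply: sumr_ge0 => d _; rewrite mulr_ge0.
Qed.

Lemma surv_rec_ge0 t S : (forall d, 0 <= wt d) -> 0 <= surv_rec wt step t S.
Proof.
move=> w0; elim: t S => [|t IH] S /=; case: ifP => // _.
by apply: sumr_ge0 => d _; rewrite mulr_ge0.
Qed.

Lemma surv_rec0 S : surv_rec wt step 0 S = 1 - hit_rec wt step 0 S.
Proof. by rewrite /=; case: ifP => _; rewrite ?subrr ?subr0. Qed.

Lemma hit_rec_surv t S : \sum_d wt d = 1 ->
  hit_rec wt step t.+1 S = surv_rec wt step t S - surv_rec wt step t.+1 S.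
Proof.
move=> w1; elim: t S => [|t IH] S.
  rewrite [LHS]/= [X in _ - X]/= surv_rec0 [in RHS]/=.
  case: eqP => _; first by rewrite !subrr.
  rewrite subr0 -[X in X - _]w1 -sumrB; apply: eq_bigr => d _.
  by case: eqP => _; rewrite ?mulr1 ?mulr0 ?subr0 ?subrr.
have -> : hit_rec wt step t.+2 S =
    if S == full then 0 else \sum_d wt d * hit_rec wt step t.+1 (step S d) by [].
rewrite [X in _ - X]/= [X in X - _]/=; case: ifP => _; first by rewrite subrr.
by rewrite -sumrB; apply: eq_bigr => d _; rewrite IH mulrBr.
Qed.

Lemma hit_rec_sum_le1 N S : \sum_d wt d = 1 -> (forall d, 0 <= wt d) ->
  \sum_(t < N) hit_rec wt step t S <= 1.
Proof.
move=> w1 w0.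
suff E : forall M, \sum_(t < M.+1) hit_rec wt step t S = 1 - surv_rec wt step M S.
  case: N => [|N]; first by rewrite big_ord0 ler01.
  by rewrite E lerBlDr lerDl surv_rec_ge0.
elim=> [|M IH]; first by rewrite big_ord1 surv_rec0 subKr.
rewrite big_ord_recr (hit_rec_surv _ _ w1).
transitivity ((1 - surv_rec wt step M S) +
  (surv_rec wt step M S - surv_rec wt step M.+1 S)); first by congr (_ + _); exact: IH.
by rewrite addrA subrK.
Qed.

(** A word of length [t] carries [t] factors. This is what makes completion without reset at time
    [t] have probability [a_t]. *)
Lemma hit_rec_scale (q : R) t S :
  hit_rec (fun d => q * wt d) step t S = q ^+ t * hit_rec wt step t S.
Proof.
elim: t S => [|t IH] S /=; first by rewrite mul1r.
case: ifP => _; first by rewrite mulr0.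
rewrite big_distrr; apply: eq_bigr => d _ /=.
by rewrite IH exprS; ring.
Qed.

End FirstDraw.

(** * The chain of collections and its last reset *)

Section Coupon.
Variables (R : realType) (n : nat) (p : 'I_n -> R).
Local Notation full := (finset.setTfor 'I_n).
Local Notation collect := (fun (S : {set 'I_n}) (i : 'I_n) => i |: S).

(** Drawing each missing coupon exactly once completes [S] in this number of draws; positivity of
    [s] rests on it. *)
Lemma collect_rec_gt0 S : (forall i, 0 < p i) ->
  0 < hit_rec p collect #|~: S| S.
Proof.
move=> p0; move: {2}#|_| (erefl #|~: S|) => k.
elim: k S => [|k IH] S hS; rewrite hS.
  move/cards0_eq: hS => hS; rewrite /= -[S]finset.setCK hS finset.setC0 eqxx.
  exact: ltr01.
have [i iS] : exists i, i \in ~: S by apply/card_gt0P; rewrite hS.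
have nf : S == full = false.
  by apply/negbTE/negP => /eqP E; move: iS; rewrite E finset.setCT finset.inE.
rewrite /= nf (bigD1 i) //=.
have hk : #|~: (i |: S)| = k.
  apply/eqP; rewrite -eqSS -hS (cardsD1 i (~: S)) iS add1n eqSS.
  by rewrite finset.setCU finset.setIC finset.setDE.
apply: ltr_wpDr; last first.
  by rewrite mulr_gt0 // -{1}hk; apply: IH.
apply: sumr_ge0 => j _; rewrite mulr_ge0 ?(ltW (p0 j)) //.
by apply: hit_rec_ge0 => l; apply: ltW.
Qed.

(* Decomposition according to the last reset before the completion time. *)
Lemma reset_renewal_rec (rho : R) t S :
  hit_rec (reset_wt rho p) (@reset_step n) t S =
  hit_rec p collect t S +
  rho * \sum_(j < t) hit_rec p collect j finset.set0 *
                     surv_rec (reset_wt rho p) (@reset_step n) (t.-1 - j) S.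
Proof.
set f := hit_rec (reset_wt rho p) _; set a := hit_rec p _.
set G := surv_rec _ _.
have sum_opt (F : option 'I_n -> R) : \sum_d F d = F None + \sum_i F (Some i).
  rewrite (bigD1 None) //=; congr (_ + _).
  rewrite (reindex_omap Some id) /=; last by case.
  by apply: eq_bigl => i; rewrite eqxx.
elim: t S => [|t IH] S; first by rewrite big_ord0 mulr0 addr0.
have fS u U : f u.+1 U = if U == full then 0 else
    rho * f u finset.set0 + \sum_i p i * f u (i |: U).
  by rewrite /f /=; case: ifP => // _; rewrite sum_opt.
have GS u U : G u.+1 U = if U == full then 0 else
    rho * G u finset.set0 + \sum_i p i * G u (i |: U).
  by rewrite /G /=; case: ifP => // _; rewrite sum_opt.
have aS u U : a u.+1 U = if U == full then 0 else \sum_i p i * a u (i |: U) by [].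
rewrite fS aS /=; case: (eqVneq S full) => [->|nf].
  rewrite big1 ?mulr0 ?addr0 // => j _.
  by case: (t - j)%N => [|u]; rewrite /G /= eqxx mulr0.
(* The term [j = t] has its last reset at the first draw. The other terms have [t - j > 0], so their
   survival factor can be opened by one draw. *)
rewrite big_ord_recr /= subnn.
have -> : G 0 S = 1 by rewrite /G /= (negbTE nf).
have -> : \sum_(j < t) a j finset.set0 * G (t - j)%N S =
  \sum_(j < t) a j finset.set0 * (rho * G (t.-1 - j)%N finset.set0
     + \sum_i p i * G (t.-1 - j)%N (i |: S)).
  apply: eq_bigr => j _.
  have -> : (t - j = (t.-1 - j).+1)%N by have := ltn_ord j; lia.
  by rewrite GS (negbTE nf).
rewrite IH (eq_bigr (fun i => p i * a t (i |: S) + rho *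
    \sum_(j < t) a j finset.set0 * (p i * G (t.-1 - j)%N (i |: S)))); last first.
  move=> i _; rewrite IH mulrDr; congr (_ + _).
  rewrite mulrCA; congr (_ * _); rewrite big_distrr /=.
  by apply: eq_bigr => j _; rewrite mulrCA.
rewrite big_split /= -big_distrr /= exchange_big /=.
have -> : \sum_(j < t) a j finset.set0 * (rho * G (t.-1 - j)%N finset.set0 +
      \sum_i p i * G (t.-1 - j)%N (i |: S)) =
    rho * (\sum_(j < t) a j finset.set0 * G (t.-1 - j)%N finset.set0) +
    \sum_(j < t) \sum_i a j finset.set0 * (p i * G (t.-1 - j)%N (i |: S)).
  rewrite big_distrr -big_split; apply: eq_bigr => j _ /=.
  by rewrite mulrDr mulrCA big_distrr.
by ring.
Qed.

End Coupon.

(** * Double sums over triangles, and binomial bounds *)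

Lemma triangular_sum {R : nmodType} (h : nat -> nat -> R) (M : nat) :
  \sum_(t < M) \sum_(j < t.+1) h j (t - j)%N =
  \sum_(j < M) \sum_(u < (M - j)%N) h j u.
Proof.
elim: M => [|M IH]; first by rewrite !big_ord0.
rewrite big_ord_recr /= IH [in RHS]big_ord_recr /= subSnn big_ord1.
rewrite [X in _ + X = _]big_ord_recr /= subnn addrA -big_split /=.
congr (_ + _); apply: eq_bigr => j _.
by rewrite subSn ?(ltnW (ltn_ord j)) // big_ord_recr.
Qed.

Lemma ler_sum_ord {R : numDomainType} (F : nat -> R) (M N : nat) :
  (M <= N)%N -> (forall t, 0 <= F t) -> \sum_(t < M) F t <= \sum_(t < N) F t.
Proof.
move=> MN F0; rewrite -(subnKC MN) big_split_ord /= lerDl.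
by apply: sumr_ge0 => i _.
Qed.

Lemma triangular_le_square {R : numDomainType} (h : nat -> nat -> R) (M : nat) :
  (forall j u, 0 <= h j u) ->
  \sum_(t < M) \sum_(j < t.+1) h j (t - j)%N <= \sum_(j < M) \sum_(u < M) h j u.
Proof.
move=> h0; rewrite triangular_sum; apply: ler_sum => j _.
by apply: (@ler_sum_ord _ (h j)) => //; rewrite leq_subr.
Qed.

(** If [j < J] and [u < N], then [j + u < J + N]. Separate side lengths let [J] tend to infinity
    with [N] fixed. *)
Lemma rectangle_le_triangular {R : numDomainType} (h : nat -> nat -> R) (J N : nat) :
  (forall j u, 0 <= h j u) ->
  \sum_(j < J) \sum_(u < N) h j u <=
  \sum_(t < (J + N)%N) \sum_(j < t.+1) h j (t - j)%N.
Proof.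
move=> h0; rewrite triangular_sum.
apply: (@le_trans _ _ (\sum_(j < J) \sum_(u < (J + N - j)%N) h j u)).
  apply: ler_sum => j _; apply: (@ler_sum_ord _ (h j)) => //.
  by have := ltn_ord j; lia.
apply: (@ler_sum_ord _ (fun j => \sum_(u < (J + N - j)%N) h j u)).
  exact: leq_addr.
by move=> t; apply: sumr_ge0.
Qed.

Lemma binomial_prob_le1 {R : numDomainType} {x : R} {i j : nat} :
  0 <= x <= 1 -> (i <= j)%N -> x ^+ i * (1 - x) ^+ (j - i) * 'C(j, i)%:R <= 1.
Proof.
move=> /andP[x0 x1] ij; have y0 : 0 <= 1 - x by rewrite subr_ge0.
have E : 1 = \sum_(k < j.+1) x ^+ k * (1 - x) ^+ (j - k) * 'C(j, k)%:R.
  rewrite -[LHS](expr1n _ j) -{1}[1](subrK x) exprDn.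
  by apply: eq_bigr => k _; rewrite -mulr_natr [_ * x ^+ k]mulrC.
rewrite [leRHS]E (bigD1 (Ordinal (ij : (i < j.+1)%N))) //= lerDl.
by apply: sumr_ge0 => k _; rewrite !mulr_ge0 ?exprn_ge0 ?ler0n.
Qed.

(** Since [k - i <= l], the power of [1 - rho] is at most the one in a binomial probability. The
    slack [i] covers exponents shifted by one, as in the derivative series. *)
Lemma damped_binomial_le1 {R : numDomainType} (rho : R) (i k l : nat) :
  0 < rho < 1 -> (k <= l + i)%N -> rho ^+ i * 'C(k, i)%:R * (1 - rho) ^+ l <= 1.
Proof.
move=> /andP[/ltW r0 /ltW r1] kl.
case: (leqP i k) => ik; last by rewrite bin_small // mulr0 mul0r ler01.
have r01 : 0 <= rho <= 1 by rewrite r0.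
apply: le_trans (binomial_prob_le1 r01 ik).
rewrite mulrAC ler_wpM2r ?ler0n // ler_wpM2l ?exprn_ge0 //.
by apply: ler_wiXn2l; [rewrite subr_ge0 | rewrite gerBl | lia].
Qed.

Lemma ffact_le_expn (t r : nat) : (t ^_ r <= t ^ r)%N.
Proof.
elim: r => [|r IH] //; rewrite ffactnSr expnSr.
by apply: leq_mul => //; apply: leq_subr.
Qed.

Lemma expn_le_ffact (t r : nat) : (t ^ r <= (t + r) ^_ r)%N.
Proof.
elim: r => [|r IH] //; rewrite addnS ffactSS expnS.
by apply: leq_mul => //; lia.
Qed.

Lemma cvg_ub_le {R : realType} {u : nat -> R} {l b : R} : (forall N, u N <= b) -> u @ \oo --> l -> l <= b.
Proof. by move=> ub ul; apply: (cvgr_to_le ul); apply: nearW. Qed.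

Lemma le_cvg_sum {R : realType} {F : nat -> R} {l : R} : (forall t, 0 <= F t) ->
  (fun N : nat => \sum_(t < N) F t) @ \oo --> l -> forall N : nat, \sum_(t < N) F t <= l.
Proof.
move=> F0 Fl N; apply: (cvgr_to_ge Fl); near=> M.
by apply: ler_sum_ord => //; near: M; apply: nbhs_infty_ge.
Unshelve. all: by end_near.
Qed.

(** * Uniform survival estimate from the renewal identity *)

Definition pmf_of_survival {R : zmodType} (G : nat -> R) (t : nat) : R :=
  if t is t'.+1 then G t' - G t'.+1 else 0.

Section Renewal.
Variables (R : realType) (rho : R) (c G : nat -> R) (s m : R).
Hypothesis rho01 : 0 < rho < 1.
Hypothesis c_ge0 : forall t, 0 <= c t.
Hypothesis c0 : c 0%N = 0.
Hypothesis c_sum : forall N : nat, \sum_(t < N) c t <= 1.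
Hypothesis G_ge0 : forall t, 0 <= G t.
Hypothesis G0 : G 0%N = 1.
Let a t := (1 - rho) ^+ t * c t.
Hypothesis renewal : forall t,
  G t - G t.+1 = a t.+1 + rho * \sum_(j < t.+1) a j * G (t - j)%N.
Hypothesis a_cvg : (fun N : nat => \sum_(t < N) a t) @ \oo --> s.
Hypothesis ta_cvg : (fun N : nat => \sum_(t < N) t%:R * a t) @ \oo --> m.
Hypothesis s_gt0 : 0 < s.

Local Notation pmf := (pmf_of_survival G).
Local Notation theta := (rho * s).

Let rho_gt0 : 0 < rho. Proof. by case/andP: rho01. Qed.
Let q_gt0 : 0 < 1 - rho. Proof. by case/andP: rho01 => _; rewrite subr_gt0. Qed.
Let q_le1 : 1 - rho <= 1. Proof. by rewrite lerBlDr lerDl ltW. Qed.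
Let rho_le1 : rho <= 1. Proof. by case/andP: rho01 => _ /ltW. Qed.

Local Lemma a_ge0 t : 0 <= a t.
Proof. by rewrite mulr_ge0 ?exprn_ge0 // ltW. Qed.

Local Lemma a_le t : a t <= c t.
Proof. by rewrite ler_piMl // exprn_ile1 // ltW. Qed.

Local Lemma a_sum_le N : \sum_(t < N) a t <= s.
Proof. exact: (le_cvg_sum a_ge0 a_cvg). Qed.

Local Lemma ta_ge0 t : 0 <= t%:R * a t.
Proof. by rewrite mulr_ge0 // a_ge0. Qed.

Local Lemma ta_sum_le N : \sum_(t < N) t%:R * a t <= m.
Proof. exact: (le_cvg_sum ta_ge0 ta_cvg). Qed.

Local Lemma m_ge0 : 0 <= m.
Proof. by have := ta_sum_le 0; rewrite big_ord0. Qed.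

Local Lemma s_le1 : s <= 1.
Proof.
apply: cvg_ub_le a_cvg => N; apply: le_trans (c_sum N).
by apply: ler_sum => t _; apply: a_le.
Qed.

Let theta_gt0 : 0 < theta. Proof. by rewrite mulr_gt0. Qed.

Lemma scale_lt1 : theta < 1.
Proof.
case/andP: rho01 => _ r1; apply: le_lt_trans r1.
by rewrite ler_piMr ?s_le1 // ltW.
Qed.

Local Lemma G_le1 t : G t <= 1.
Proof.
elim: t => [|t IH]; first by rewrite G0.
apply: le_trans IH; rewrite -subr_ge0 renewal.
rewrite addr_ge0 ?a_ge0 // mulr_ge0 ?(ltW rho_gt0) //.
by apply: sumr_ge0 => j _; rewrite mulr_ge0 ?a_ge0.
Qed.

Lemma pmf_ge0 t : 0 <= pmf t.
Proof.
case: t => [|t] //=; rewrite renewal.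
rewrite addr_ge0 ?a_ge0 // mulr_ge0 ?(ltW rho_gt0) //.
by apply: sumr_ge0 => j _; rewrite mulr_ge0 ?a_ge0.
Qed.

Lemma pmf_sum N : \sum_(t < N.+1) pmf t = 1 - G N.
Proof.
rewrite big_ord_recl /= add0r; elim: N => [|N IH]; first by rewrite big_ord0 G0 subrr.
by rewrite big_ord_recr /= IH addrA subrK.
Qed.

Let S (t : nat) : R := \sum_(u < t) G u.

(** The renewal identity is summed over the times below [t], and the double sum is regrouped by
    [j]. *)
Lemma cdf_convolution t :
  1 - G t = \sum_(u < t) a u.+1 + rho * \sum_(j < t) a j * S (t - j)%N.
Proof.
have -> : 1 - G t = \sum_(u < t) (G u - G u.+1).
  by rewrite -pmf_sum big_ord_recl /= add0r.
under eq_bigr => u _ do rewrite renewal.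
rewrite big_split /= -big_distrr /=.
congr (_ + _ * _); rewrite (triangular_sum (fun j u => a j * G u)).
by apply: eq_bigr => j _; rewrite big_distrr.
Qed.

Lemma cdf_le t : 1 - G t <= s + theta * S t.
Proof.
rewrite cdf_convolution; apply: lerD.
  (* As [a 0 = 0], the shifted sum is itself a partial sum of the series for [s]. *)
  by have := a_sum_le t.+1; rewrite big_ord_recl /= /a c0 mulr0 add0r.
rewrite -mulrA ler_wpM2l ?(ltW rho_gt0) //.
apply: le_trans (_ : \sum_(j < t) a j * S t <= _).
  apply: ler_sum => j _; rewrite ler_wpM2l ?a_ge0 //.
  by apply: ler_sum_ord => //; rewrite leq_subr.
by rewrite -big_distrl /= ler_wpM2r ?a_sum_le // sumr_ge0.
Qed.

(** [S] grows by at most 1 per step, so replacing [S (t - j)] by [S t] costs at most [j]; weighted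
    by [a j], the total cost is at most [m]. *)
Lemma cdf_ge t : theta * S t - rho * m <= 1 - G t.
Proof.
rewrite -mulrA -mulrBr cdf_convolution; apply: ler_wpDl.
  by apply: sumr_ge0 => u _; apply: a_ge0.
rewrite ler_wpM2l ?(ltW rho_gt0) //.
(* [s] and [m] are known as limits, so the inequality is proved for truncations at [N >= t]. *)
have H : (fun N : nat => (\sum_(j < N) a j) * S t - \sum_(j < N) j%:R * a j)
     @ \oo --> s * S t - m by apply: cvgB ta_cvg; apply: cvgMl.
apply: (cvgr_to_le H); near=> N.
have tN : (t <= N)%N by near: N; apply: nbhs_infty_ge.
have Sadd u k : S (u + k)%N <= S u + k%:R.
  rewrite /S big_split_ord /= lerD2l -[X in _ <= X%:R](card_ord k) -sumr_const.
  by apply: ler_sum => j _; apply: G_le1.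
have St k : (k <= t)%N -> S t - k%:R <= S (t - k)%N.
  by move=> kt; rewrite lerBlDr; have := Sadd (t - k)%N k; rewrite subnK.
rewrite big_distrl /= -sumrB -(subnKC tN) big_split_ord /=.
rewrite -[leRHS]addr0; apply: lerD.
  apply: ler_sum => j _; rewrite [_ * a j]mulrC -mulrBr ler_wpM2l ?a_ge0 //.
  by apply: St; apply: ltnW.
(* Indices beyond [t] have no counterpart on the right; there [S t <= t <= j] makes each term
   nonpositive. *)
apply: sumr_le0 => j _; rewrite [_ * a _]mulrC -mulrBr mulr_ge0_le0 ?a_ge0 // subr_le0.
have S_le : S t <= t%:R by have := Sadd 0%N t; rewrite add0n /S big_ord0 add0r.
by apply: le_trans S_le _; rewrite ler_nat leq_addr.
Unshelve. all: by end_near.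
Qed.

Lemma survival_geometric t : `|G t - (1 - theta) ^+ t| <= s + rho * m.
Proof.
have rm0 : 0 <= rho * m by rewrite mulr_ge0 ?m_ge0 // ltW.
have t1 := scale_lt1; have t0 := theta_gt0.
(* Call the middle term [d_t]. Then [d_(t+1) = (1 - theta) * d_t - theta * e_t], where
   [e_t = G t - 1 + theta * S t] lies in [[- s, rho * m]]. A convex combination keeps the bounds, so
   errors do not accumulate; finally [G t - (1 - theta) ^+ t = e_t + d_t]. *)
have H : - (rho * m) <= 1 - theta * S t - (1 - theta) ^+ t <= s.
  elim: t => [|t /andP[IH1 IH2]].
    by rewrite /S big_ord0 mulr0 subr0 expr0 subrr oppr_le0 rm0 ltW.
  have := cdf_le t; have := cdf_ge t.
  have -> : S t.+1 = S t + G t by rewrite /S big_ord_recr.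
  rewrite exprS.
  set g := G t; set x := S t in IH1 IH2 *; set y := _ ^+ t in IH1 IH2 *.
  move: IH1 IH2; set th := theta in t1 t0 *; set rm := rho * m.
  set d := 1 - th * x - y => IH1 IH2 g1 g2.
  have -> : 1 - th * (x + g) - (1 - th) * y =
      (1 - th) * d - th * (g - 1 + th * x) by rewrite /d; ring.
  have t2 : 0 <= 1 - th by rewrite subr_ge0 ltW.
  have A1 := ler_wpM2l t2 IH1; have A2 := ler_wpM2l t2 IH2.
  have B1 : th * (g - 1 + th * x) <= th * rm by rewrite ler_pM2l //; lra.
  have B2 : th * (- s) <= th * (g - 1 + th * x) by rewrite ler_pM2l //; lra.
  by apply/andP; split; lra.
case/andP: H => H1 H2; have := cdf_le t; have := cdf_ge t => g1 g2.
by rewrite ler_norml; apply/andP; split; lra.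
Qed.

(** * Truncated factorial moments and ordinary moments *)

Let w r (N : nat) : R := \sum_(u < N) 'C(u, r)%:R * G u.
Let F r (N : nat) : R := \sum_(t < N) 'C(t, r)%:R * pmf t.

(** Summation by parts with Pascal's rule. *)
Lemma factorial_moment_by_tails r M :
  F r.+1 M.+1 = w r M - 'C(M, r.+1)%:R * G M.
Proof.
elim: M => [|M IH].
  by rewrite /F /w big_ord1 big_ord0 /= mulr0 bin0n mul0r subrr.
rewrite {1}/F big_ord_recr -/(F r.+1 M.+1) IH [X in _ = X - _]/w big_ord_recr /=.
by rewrite -/(w r M) binS natrD; ring.
Qed.

Lemma factorial_moment_renewal r N : F r N.+1 =
  \sum_(t < N) 'C(t.+1, r)%:R * (a t.+1 + rho * \sum_(j < t.+1) a j * G (t - j)%N).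
Proof.
rewrite /F big_ord_recl mulr0 add0r; apply: eq_bigr => t _.
by congr (_ * _); apply: renewal.
Qed.

(** The completion term is dropped and ['C(t.+1, r)] is lowered to ['C(t - j, r)], which decouples
    the two indices. *)
Lemma factorial_moment_ge r J N :
  rho * (\sum_(j < J) a j) * w r N <= F r (J + N).+1.
Proof.
rewrite factorial_moment_renewal -mulrA.
have h0 j u : 0 <= a j * ('C(u, r)%:R * G u).
  by rewrite mulr_ge0 ?a_ge0 // mulr_ge0.
have /= := rectangle_le_triangular _ J N h0.
under eq_bigr => j _ do rewrite -big_distrr /=.
rewrite -big_distrl /= => /(ler_wpM2l (ltW rho_gt0)) /le_trans; apply.
rewrite big_distrr /=; apply: ler_sum => t _.
rewrite mulrDr; apply: ler_wpDl.
  by rewrite mulr_ge0 ?a_ge0.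
rewrite mulrCA ler_wpM2l ?(ltW rho_gt0) // big_distrr /=.
apply: ler_sum => j _; rewrite [leRHS]mulrCA ler_wpM2l ?a_ge0 // ler_wpM2r //.
by rewrite ler_nat leq_bin2l //; lia.
Qed.

(** Letting [J] grow with [N] fixed turns the partial sum of [a] into [s], which supplies the extra
    factor [theta]. *)
Lemma scaled_factorial_tails_le1 r N :
  (forall M, theta ^+ r * F r M <= 1) -> theta ^+ r.+1 * w r N <= 1.
Proof.
move=> Fr.
have H : (fun J : nat => theta ^+ r * (rho * (\sum_(j < J) a j) * w r N)) @ \oo -->
    theta ^+ r * (rho * s * w r N).
  by apply: cvgMr; apply: cvgMl; apply: cvgMr.
rewrite exprSr -mulrA; apply: cvg_ub_le H => J.
apply: le_trans (Fr (J + N).+1); rewrite ler_wpM2l ?exprn_ge0 ?(ltW theta_gt0) //.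
exact: factorial_moment_ge.
Qed.

(** The induction alternates: a bound on [F r] gives one on [w r], which dominates [F r.+1] because
    the boundary term is subtracted. *)
Lemma scaled_factorial_moment_le1 r M : theta ^+ r * F r M <= 1.
Proof.
elim: r M => [|r IH] [|M]; rewrite ?[F _ 0%N]/F ?big_ord0 ?mulr0 ?ler01 //.
  rewrite mul1r /F; under eq_bigr => t _ do rewrite bin0 mul1r.
  by rewrite pmf_sum lerBlDr lerDl.
apply: le_trans (scaled_factorial_tails_le1 _ M IH).
rewrite ler_wpM2l ?exprn_ge0 ?(ltW theta_gt0) // factorial_moment_by_tails.
by rewrite lerBlDr lerDl mulr_ge0.
Qed.

Lemma damped_binomial_sum_le1 i (k : nat -> nat) (N : nat) :
  (forall j, k j <= j + i)%N -> rho ^+ i * \sum_(j < N) 'C(k j, i)%:R * a j <= 1.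
Proof.
move=> kj; apply: le_trans (c_sum N); rewrite big_distrr /=.
apply: ler_sum => j _; rewrite /a !mulrA ler_piMl //.
exact: damped_binomial_le1.
Qed.

(** For [r > 0], the factor [rho ^+ r] is spent on the damped binomial sum and [s ^+ r <= s]
    remains. *)
Lemma completion_binomial_le r (N : nat) :
  theta ^+ r * \sum_(t < N) 'C(t.+1, r)%:R * a t.+1 <= s.
Proof.
have -> : \sum_(t < N) 'C(t.+1, r)%:R * a t.+1 = \sum_(t < N.+1) 'C(t, r)%:R * a t.
  by rewrite big_ord_recl /= [a 0%N]/a c0 !mulr0 add0r.
case: r => [|r].
  by rewrite mul1r; under eq_bigr => t _ do rewrite bin0 mul1r; apply: a_sum_le.
rewrite exprMn [rho ^+ _ * _]mulrC -mulrA -[leRHS]mulr1.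
apply: ler_pM; rewrite ?exprn_ge0 ?(ltW s_gt0) //.
- rewrite mulr_ge0 ?exprn_ge0 ?(ltW rho_gt0) //.
  by apply: sumr_ge0 => j _; rewrite mulr_ge0 ?a_ge0.
- by rewrite exprS ler_piMr ?(ltW s_gt0) // exprn_ile1 ?s_le1 // ltW.
- by apply: (damped_binomial_sum_le1 _ id) => j; apply: leq_addr.
Qed.

(** The prefactor has exactly the [i.+1] powers of [rho] that damp ['C(j.+1, i.+1)]. For [i > 0] a
    factor [s] is left over; for [i = 0] none is, and [j + 1] is summed directly, whence
    [rho * m]. *)
Lemma shifted_completion_binomial_le i (N : nat) :
  theta ^+ i * (rho * \sum_(j < N) 'C(j.+1, i.+1)%:R * a j) <=
  (i == 0%N)%:R * (rho * m) + s.
Proof.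
case: i => [|i].
  rewrite !mul1r; under eq_bigr => j _ do rewrite bin1 -addn1 natrD mulrDl mul1r.
  rewrite big_split /= mulrDr; apply: lerD.
    by rewrite ler_wpM2l ?(ltW rho_gt0) // ta_sum_le.
  apply: le_trans (a_sum_le N); rewrite ler_piMl //.
  by apply: sumr_ge0 => j _; apply: a_ge0.
rewrite mul0r add0r exprMn.
set X := \sum_(_ < _) _.
have -> : rho ^+ i.+1 * s ^+ i.+1 * (rho * X) = s ^+ i.+1 * (rho ^+ i.+2 * X).
  by rewrite [rho ^+ i.+2]exprS; ring.
rewrite -[leRHS]mulr1.
apply: ler_pM; rewrite ?exprn_ge0 ?(ltW s_gt0) //.
- rewrite mulr_ge0 ?exprn_ge0 ?(ltW rho_gt0) //.
  by apply: sumr_ge0 => j _; rewrite mulr_ge0 ?a_ge0.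
- by rewrite exprS ler_piMr ?(ltW s_gt0) // exprn_ile1 ?s_le1 // ltW.
- by apply: (damped_binomial_sum_le1 _ succn) => j; lia.
Qed.

(** Since [t.+1 = j.+1 + (t - j)], Vandermonde's formula splits the binomial; enlarging the triangle
    to a square separates the sums. *)
Lemma factorial_moment_convolution_le r N :
  F r N.+1 <= \sum_(t < N) 'C(t.+1, r)%:R * a t.+1 +
    \sum_(i < r.+1) (rho * \sum_(j < N) 'C(j.+1, i)%:R * a j) * w (r - i)%N N.
Proof.
rewrite factorial_moment_renewal; under eq_bigr => t _ do rewrite mulrDr.
rewrite big_split /= lerD2l.
pose h j u := 'C(j.+1 + u, r)%:R * (a j * G u).
have h0 j u : 0 <= h j u by rewrite /h mulr_ge0 // mulr_ge0 ?a_ge0.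
have -> : \sum_(t < N) 'C(t.+1, r)%:R * (rho * \sum_(j < t.+1) a j * G (t - j)%N) =
    rho * \sum_(t < N) \sum_(j < t.+1) h j (t - j)%N.
  rewrite big_distrr; apply: eq_bigr => t _ /=.
  rewrite mulrCA; congr (_ * _); rewrite big_distrr; apply: eq_bigr => j _ /=.
  by rewrite /h addSn subnKC // -ltnS.
apply: le_trans (ler_wpM2l (ltW rho_gt0) (triangular_le_square _ N h0)) _.
under [leRHS]eq_bigr => i _ do rewrite -mulrA.
rewrite -big_distrr /= ler_wpM2l ?(ltW rho_gt0) // le_eqVlt; apply/orP; left.
apply/eqP; under [RHS]eq_bigr => i _ do rewrite big_distrl /=.
rewrite [RHS]exchange_big /=; apply: eq_bigr => j _.
under [RHS]eq_bigr => i _ do rewrite big_distrr /=.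
rewrite [RHS]exchange_big /=; apply: eq_bigr => u _.
rewrite /h -binomial.Vandermonde natr_sum big_distrl /=; apply: eq_bigr => i _.
by rewrite natrM; ring.
Qed.

(** Vandermonde index 0 gives the main term. Each of the [r] other indices costs at most [s], the
    first of them also [rho * m], and the completion term costs one more [s]. *)
Lemma scaled_factorial_moment_le r N :
  theta ^+ r * F r N.+1 <= theta ^+ r.+1 * w r N + (rho * m + r.+1%:R * s).
Proof.
have th0 k : 0 <= theta ^+ k by rewrite exprn_ge0 // ltW.
have w0 k : 0 <= w k N by apply: sumr_ge0 => u _; rewrite mulr_ge0.
apply: le_trans (ler_wpM2l (th0 r) (factorial_moment_convolution_le r N)) _.
rewrite mulrDr addrC big_ord_recl mulrDr -addrA; apply: lerD.
  rewrite exprSr -[X in _ <= X]mulrA ler_wpM2l // subn0 ler_wpM2r //.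
  rewrite ler_wpM2l ?(ltW rho_gt0) //.
  by under eq_bigr => j _ do rewrite bin0 mul1r; apply: a_sum_le.
rewrite -natr1 mulrDl mul1r addrA; apply: lerD; last exact: completion_binomial_le.
rewrite big_distrr /=.
apply: le_trans (_ : \sum_(i < r) ((val i == 0%N)%:R * (rho * m) + s) <= _).
  apply: ler_sum => i _; rewrite /bump /= add1n.
  apply: le_trans _ (shifted_completion_binomial_le i N).
  set Y := rho * \sum_(_ < _) _; have Y0 : 0 <= Y.
    rewrite mulr_ge0 ?(ltW rho_gt0) //.
    by apply: sumr_ge0 => j _; rewrite mulr_ge0 ?a_ge0.
  (* Here [i] is the Vandermonde index less 1; the second power is the one that bounds the tail sum
     [w] by 1. *)
  have -> : theta ^+ r = theta ^+ i * theta ^+ (r - i.+1).+1.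
    by rewrite -exprD; congr (_ ^+ _); have := ltn_ord i; lia.
  rewrite -mulrA ler_wpM2l // mulrCA ler_piMr //.
  exact/scaled_factorial_tails_le1/scaled_factorial_moment_le1.
rewrite big_split /= sumr_const card_ord -(mulr_natl s) lerD2r -big_distrl /=.
rewrite ler_piMl ?mulr_ge0 ?m_ge0 ?(ltW rho_gt0) //.
case: r {w0} => [|r]; first by rewrite big_ord0 ler01.
by rewrite big_ord_recl /= big1 ?addr0.
Qed.

Local Lemma w_cvg r : w r @ \oo --> limn (w r).
Proof.
apply: nondecreasing_is_cvgn.
  by move=> k l kl; apply: (@ler_sum_ord _ (fun u => 'C(u, r)%:R * G u)) => // u; rewrite mulr_ge0.
exists (theta ^- r.+1) => _ [N _ <-].
rewrite -[leRHS]mulr1 -ler_pdivrMl ?invr_gt0 ?exprn_gt0 // invrK.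
exact/scaled_factorial_tails_le1/scaled_factorial_moment_le1.
Qed.

(** These are the terms of a convergent series. The boundary term of [factorial_moment_by_tails]
    thus vanishes in the limit. *)
Lemma binomial_tail_cvg0 r : (fun N => 'C(N, r)%:R * G N) @ \oo --> (0 : R).
Proof.
apply: cvg_series_cvg_0; apply/cvg_ex; exists (limn (w r)).
rewrite /series /=; under eq_fun => N do rewrite big_mkord.
exact: w_cvg.
Qed.

Lemma factorial_moment_cvg r : (fun N => F r.+1 N.+1) @ \oo --> limn (w r).
Proof.
under eq_fun => N do rewrite factorial_moment_by_tails.
by have := cvgB (w_cvg r) (binomial_tail_cvg0 r.+1); rewrite subr0; exact.
Qed.

(** From total mass 1, each of [r.+1] steps loses at most [rho * m + r.+1%:R * s], the largest of
    the step losses. *)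
Lemma lim_scaled_factorial_tails_ge r :
  1 - r.+1%:R * (rho * m + r.+1%:R * s) <= theta ^+ r.+1 * limn (w r).
Proof.
have rm0 : 0 <= rho * m by rewrite mulr_ge0 ?m_ge0 // ltW.
have wc k l : (fun N => theta ^+ k * w l N + (rho * m + k%:R * s)) @ \oo -->
    theta ^+ k * limn (w l) + (rho * m + k%:R * s).
  by apply: cvgD; [apply: cvgMr; apply: w_cvg | apply: cvg_cst].
elim: r => [|r IH].
  have H0 : (fun N => theta ^+ 0 * F 0%N N.+1) @ \oo --> (1 : R).
    have -> : (fun N => theta ^+ 0 * F 0%N N.+1) = (fun N => 1 - 'C(N, 0)%:R * G N).
      apply/funext => N; rewrite mul1r bin0 mul1r -pmf_sum.
      by apply: eq_bigr => t _; rewrite bin0 mul1r.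
    by have := cvgB (cvg_cst (1 : R)) (binomial_tail_cvg0 0); rewrite subr0; exact.
  have L : 1 <= theta ^+ 1 * limn (w 0%N) + (rho * m + 1%:R * s).
    by apply: ler_cvg_to H0 (wc 1%N 0%N) _; apply: nearW => N; apply: scaled_factorial_moment_le.
  by rewrite !mul1r lerBlDr; rewrite mul1r in L.
have Hr : (fun N => theta ^+ r.+1 * F r.+1 N.+1) @ \oo --> theta ^+ r.+1 * limn (w r).
  by apply: cvgMr; apply: factorial_moment_cvg.
have L : theta ^+ r.+1 * limn (w r) <=
    theta ^+ r.+2 * limn (w r.+1) + (rho * m + r.+2%:R * s).
  by apply: ler_cvg_to Hr (wc r.+2 r.+1) _; apply: nearW => N; apply: scaled_factorial_moment_le.
have rs : 0 <= r.+1%:R * s by rewrite mulr_ge0 // ltW.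
have -> : r.+2%:R * (rho * m + r.+2%:R * s) =
    r.+1%:R * (rho * m + r.+1%:R * s) + (rho * m + r.+2%:R * s) + r.+1%:R * s.
  by rewrite -[r.+2%:R]natr1; ring.
move: IH L rs; set x := theta ^+ r.+1 * _; set y := theta ^+ r.+2 * _; lra.
Qed.

Lemma scaled_factorial_moment_ge r B : (forall N, theta ^+ r.+1 * F r.+1 N <= B) ->
  1 - r.+1%:R * (rho * m + r.+1%:R * s) <= B.
Proof.
move=> FB; apply: le_trans (lim_scaled_factorial_tails_ge r) _.
apply: (@cvg_ub_le _ (fun N => theta ^+ r.+1 * F r.+1 N.+1)) => [N|]; first exact: FB.
by apply: cvgMr; apply: factorial_moment_cvg.
Qed.

(** After [t ^ r <= (t + r) ^_ r] and Vandermonde, the bound 1 on scaled factorial moments leaves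
    the binomial expansion of [(1 + theta) ^+ r]. *)
Lemma moment_le r (N : nat) :
  \sum_(t < N) pmf t * (theta * t%:R) ^+ r <= r`!%:R * (1 + theta) ^+ r.
Proof.
have th0 k : 0 <= theta ^+ k by rewrite exprn_ge0 // ltW.
apply: le_trans (_ : \sum_(t < N) r`!%:R *
    \sum_(i < r.+1) 'C(r, i)%:R * theta ^+ i *
      (theta ^+ (r - i) * ('C(t, r - i)%:R * pmf t)) <= _).
  apply: ler_sum => t _.
  have -> : \sum_(i < r.+1) 'C(r, i)%:R * theta ^+ i *
      (theta ^+ (r - i) * ('C(t, r - i)%:R * pmf t)) =
      theta ^+ r * pmf t * 'C(r + t, r)%:R.
    rewrite -binomial.Vandermonde natr_sum big_distrr; apply: eq_bigr => i _ /=.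
    have -> : theta ^+ r = theta ^+ i * theta ^+ (r - i).
      by rewrite -exprD subnKC // -ltnS.
    by rewrite natrM; ring.
  rewrite exprMn mulrCA [leRHS]mulrC -!mulrA ler_wpM2l // ler_wpM2l ?pmf_ge0 //.
  rewrite -natrX -natrM bin_ffact ler_nat addnC.
  exact: expn_le_ffact.
rewrite -big_distrr /= ler_wpM2l // exchange_big /=.
rewrite exprDn; apply: ler_sum => i _; rewrite -!big_distrr /= expr1n mul1r.
rewrite -[X in _ <= X]mulr_natl -[leRHS]mulr1.
by rewrite ler_wpM2l ?mulr_ge0 // scaled_factorial_moment_le1.
Qed.

Lemma moment_ge r B : (0 < r)%N ->
  (forall N : nat, \sum_(t < N) pmf t * (theta * t%:R) ^+ r <= B) ->
  r`!%:R * (1 - r%:R * (rho * m + r%:R * s)) <= B.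
Proof.
case: r => // r _ HB; have f0 : 0 < r.+1`!%:R :> R by rewrite ltr0n fact_gt0.
rewrite -ler_pdivlMl //; apply: scaled_factorial_moment_ge => N.
rewrite ler_pdivlMl //; apply: le_trans (HB N).
rewrite mulrA big_distrr /=; apply: ler_sum => t _.
rewrite [(theta * t%:R) ^+ _]exprMn.
have -> : r.+1`!%:R * theta ^+ r.+1 * ('C(t, r.+1)%:R * pmf t) =
  pmf t * (theta ^+ r.+1 * (t ^_ r.+1)%:R) by rewrite -bin_ffact natrM; ring.
rewrite ler_wpM2l ?pmf_ge0 // ler_wpM2l ?exprn_ge0 ?(ltW theta_gt0) //.
by rewrite -natrX ler_nat ffact_le_expn.
Qed.

End Renewal.

(** * Series as limits of partial sums; geometric against exponential tails *)

Lemma bounded_nneseries {R : realType} {u : nat -> R} {B : R} :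
  (forall t, 0 <= u t) -> (forall N : nat, \sum_(t < N) u t <= B) ->
  exists2 l, (\sum_(0 <= t <oo) (u t)%:E)%E = l%:E &
    (fun N : nat => \sum_(t < N) u t) @ \oo --> l.
Proof.
move=> u0 uB.
have ul : (fun N : nat => \sum_(t < N) u t) @ \oo --> limn (fun N : nat => \sum_(t < N) u t).
  apply: nondecreasing_is_cvgn; last by exists B => _ [N _ <-].
  by move=> k l kl; apply: ler_sum_ord.
exists (limn (fun N : nat => \sum_(t < N) u t)) => //.
rewrite -EFin_lim; last by apply/cvg_ex; eexists; exact: ul.
by congr (limn _); apply/funext => N /=; rewrite sumEFin big_mkord.
Qed.

Lemma scaled_cdf_lt0 {R : realType} (law : nat -> R) (theta x : R) :
  0 < theta -> x < 0 -> scaled_cdf law theta x = 0.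
Proof.
move=> th0 x0; rewrite /scaled_cdf eseries0 // => t _ _.
case: ifP => // /le_lt_trans/(_ x0); rewrite ltNge mulr_ge0 //; exact: ltW.
Qed.

Lemma scaled_cdf_truncn {R : realType} (law : nat -> R) (theta x : R) :
  (forall t, 0 <= law t) -> 0 < theta -> 0 <= x ->
  scaled_cdf law theta x = \sum_(t < (Num.truncn (x / theta)).+1) law t.
Proof.
move=> law0 th0 x0; rewrite /scaled_cdf; set N := Num.truncn _.
have xth0 : 0 <= x / theta by rewrite divr_ge0 // ltW.
have E t : (theta * t%:R <= x) = (t <= N)%N.
  by rewrite truncn_ge_nat // ler_pdivlMr // mulrC.
rewrite (nneseries_split 0 N.+1); last first.
  by move=> t _; rewrite lee_fin; case: ifP.
rewrite eseries0 ?adde0; last first.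
  by move=> t; rewrite add0n E ltnNge => /negbTE ->.
rewrite sumEFin /= add0n big_mkord; apply: eq_bigr => t _.
by rewrite E -ltnS ltn_ord.
Qed.

(** Both sides use [1 + y <= expR y], at [y = theta / (1 - theta)] and [y = - theta], together with
    [N * theta <= x < (N + 1) * theta]. *)
Lemma geometric_survival_bounds {R : realType} {theta x : R} :
  0 < theta < 1 -> 0 <= x ->
  expR (- (x / (1 - theta))) <= (1 - theta) ^+ Num.truncn (x / theta) <= expR (theta - x).
Proof.
move=> /andP[th0 th1] x0; set N := Num.truncn _.
have p0 : 0 < 1 - theta by rewrite subr_gt0.
have /truncn_itv/andP[N1 N2] : 0 <= x / theta by rewrite divr_ge0 // ltW.
rewrite ler_pdivlMr // in N1; rewrite ltr_pdivrMr // in N2.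
apply/andP; split.
- apply: le_trans (_ : expR (- (theta / (1 - theta))) ^+ N <= _); last first.
    apply: lerXn2r; rewrite ?nnegrE ?expR_ge0 ?(ltW p0) //.
    rewrite expRN -[leRHS]invrK lef_pV2 ?posrE ?expR_gt0 ?invr_gt0 //.
    have E : (1 - theta)^-1 = 1 + theta / (1 - theta) by field; rewrite gt_eqF.
    rewrite [leLHS]E; exact: expR_ge1Dx.
  rewrite -expRM_natl ler_expR mulrN lerN2 mulrA.
  by rewrite ler_pM2r ?invr_gt0.
- apply: le_trans (_ : expR (- theta) ^+ N <= _).
    by apply: lerXn2r; rewrite ?nnegrE ?expR_ge0 ?(ltW p0) // expR_ge1Dx.
  rewrite -expRM_natl ler_expR; move: N2; rewrite -natr1 => N2.
  by move: (ltW N2); lra.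
Qed.

(** * The reset collector as an instance of the renewal identity *)

Section ResetCollector.
Variables (R : realType) (n : nat) (rho : R) (p : 'I_n -> R).
Hypothesis n_gt0 : (0 < n)%N.
Hypothesis rho01 : 0 < rho < 1.
Hypothesis p_gt0 : forall i, 0 < p i.
Hypothesis p_sum : \sum_i p i = 1 - rho.

Let c := C_law (coupon_pi rho p).
Let G t := surv_rec (reset_wt rho p) (@reset_step n) t finset.set0.
Local Notation s := (s_of rho p).
Let m := (1 - rho) * dpgf c (1 - rho).
Let a t := (1 - rho) ^+ t * c t.

Let rho_gt0 : 0 < rho. Proof. by case/andP: rho01. Qed.
Let q_gt0 : 0 < 1 - rho. Proof. by case/andP: rho01 => _; rewrite subr_gt0. Qed.

Let pi_ge0 i : 0 <= coupon_pi rho p i.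
Proof. by rewrite divr_ge0 ?ltW. Qed.

Let pi_sum : \sum_i coupon_pi rho p i = 1.
Proof. by rewrite -big_distrl /= p_sum divff // gt_eqF. Qed.

Let wt_ge0 d : 0 <= reset_wt rho p d.
Proof. by case: d => [i|] /=; rewrite ltW. Qed.

Let wt_sum : \sum_d reset_wt rho p d = 1.
Proof.
rewrite (bigD1 None) //= (reindex_omap Some id) /=; last by case.
rewrite (eq_bigl xpredT) => [|i]; last by rewrite eqxx.
by rewrite p_sum addrC subrK.
Qed.

Let empty_neq_full : (finset.set0 == finset.setTfor 'I_n) = false.
Proof.
apply/negbTE/eqP => /setP/(_ (Ordinal n_gt0)).
by rewrite !finset.inE.
Qed.

Let c_ge0 t : 0 <= c t.
Proof. by rewrite /c /C_law hit_lawE hit_rec_ge0. Qed.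

Let c0 : c 0%N = 0.
Proof. by rewrite /c /C_law hit_lawE /= empty_neq_full. Qed.

Let c_sum (N : nat) : \sum_(t < N) c t <= 1.
Proof.
rewrite /c /C_law; under eq_bigr => t _ do rewrite hit_lawE.
exact: hit_rec_sum_le1.
Qed.

Let G_ge0 t : 0 <= G t. Proof. exact: surv_rec_ge0. Qed.

Let G0 : G 0%N = 1. Proof. by rewrite /G /= empty_neq_full. Qed.

Let aE t : hit_rec p (fun S (i : 'I_n) => i |: S) t finset.set0 = a t.
Proof.
rewrite /a /c /C_law hit_lawE -hit_rec_scale; congr (hit_rec _ _ _ _).
by apply/funext => i; rewrite /coupon_pi mulrC divfK // gt_eqF.
Qed.

Let renewal t :
  G t - G t.+1 = a t.+1 + rho * \sum_(j < t.+1) a j * G (t - j)%N.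
Proof.
rewrite /G -hit_rec_surv // reset_renewal_rec aE; congr (_ + _ * _).
by apply: eq_bigr => j _; rewrite aE.
Qed.

Lemma T_lawE : T_law rho p = pmf_of_survival G.
Proof.
apply/funext => -[|t]; rewrite /T_law hit_lawE; first by rewrite /= empty_neq_full.
exact: hit_rec_surv.
Qed.

Let a_ge0 t : 0 <= a t.
Proof. by rewrite mulr_ge0 ?exprn_ge0 // ltW. Qed.

Let a_cvg : (fun N : nat => \sum_(t < N) a t) @ \oo --> s.
Proof.
rewrite /s_of /pgf; under eq_eseriesr => t _ do rewrite mulrC.
have [||l -> //] := @bounded_nneseries R a 1 => // N.
apply: le_trans (c_sum N); apply: ler_sum => t _.
by rewrite ler_piMl // exprn_ile1 // ?(ltW q_gt0) // gerBl ltW.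
Qed.

Let ta_cvg : (fun N : nat => \sum_(t < N) t%:R * a t) @ \oo --> m.
Proof.
pose u t : R := t%:R * c t * (1 - rho) ^+ t.-1.
have u0 t : 0 <= u t by rewrite /u !mulr_ge0 // exprn_ge0 // ltW.
(* The damped binomial bound with [i = 1] gives [rho * t * (1 - rho) ^ (t - 1) <= 1]. *)
have uB (N : nat) : \sum_(t < N) u t <= rho^-1.
  rewrite -[leRHS]mulr1 -ler_pdivrMl ?invr_gt0 // invrK.
  apply: le_trans (c_sum N); rewrite big_distrr; apply: ler_sum => t _ /=.
  have := @damped_binomial_le1 R rho 1 t t.-1 rho01.
  rewrite bin1 expr1 addn1 leqSpred => /(_ isT) H.
  have -> : rho * u t = rho * t%:R * (1 - rho) ^+ t.-1 * c t by rewrite /u; ring.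
  by rewrite ler_piMl.
have [l El ul] := bounded_nneseries u0 uB.
have -> : m = (1 - rho) * l.
  rewrite /m /dpgf; congr (_ * _).
  (* [dpgf] starts at index 1; the term of [u] at 0 vanishes. *)
  move: El; rewrite (nneseries_split 0 1); last by move=> k _; rewrite lee_fin.
  by rewrite add0n big_nat1 /u !mul0r add0e => ->.
have -> : (fun N : nat => \sum_(t < N) t%:R * a t) =
    (fun N : nat => (1 - rho) * \sum_(t < N) u t).
  apply/funext => N; rewrite big_distrr; apply: eq_bigr => -[[|t] /= _] _.
    by rewrite /u !mul0r mulr0.
  by rewrite /u /a exprS /=; ring.
exact: cvgMr.
Qed.

Lemma s_of_gt0 : 0 < s.
Proof.
have an : 0 < a n.
  rewrite -aE; have := @collect_rec_gt0 R n p finset.set0 p_gt0.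
  by rewrite finset.setC0 cardsT card_ord.
apply: lt_le_trans an _; apply: le_trans (le_cvg_sum a_ge0 a_cvg n.+1).
by rewrite big_ord_recr /= lerDr sumr_ge0.
Qed.

Lemma scale_in01 : 0 < rho * s < 1.
Proof.
by rewrite mulr_gt0 ?s_of_gt0 //= (scale_lt1 _ _ _ _ rho01 c_ge0 c_sum a_cvg).
Qed.

Lemma T_law_ge0 t : 0 <= T_law rho p t.
Proof. by rewrite /T_law hit_lawE hit_rec_ge0. Qed.

(** With [N] the integer part of [x / (rho * s)], the distribution function equals [1 - G N], to
    which the uniform survival estimate applies. *)
Lemma scaled_cdf_T_law_bounds x : 0 <= x ->
  1 - expR (rho * s - x) - (s + rho * m) <= scaled_cdf (T_law rho p) (rho * s) x <=
  1 - expR (- (x / (1 - rho * s))) + (s + rho * m).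
Proof.
move=> x0; have th01 := scale_in01; have /andP[th0 th1] := th01.
rewrite scaled_cdf_truncn //; last exact: T_law_ge0.
rewrite T_lawE pmf_sum //.
have /andP[H1 H2] := geometric_survival_bounds th01 x0.
have := survival_geometric _ _ _ _ _ _ rho01 c_ge0 c0 c_sum G_ge0 G0 renewal
  a_cvg ta_cvg s_of_gt0 (Num.truncn (x / (rho * s))).
rewrite ler_norml => /andP[H3 H4].
move: H1 H2 H3 H4; move: (_ ^+ Num.truncn _) (G _) (s + _) => y g e H1 H2 H3 H4.
by apply/andP; split; lra.
Qed.

Lemma scaled_moment_T_law_bounds r : (0 < r)%N ->
  ((r`!%:R * (1 - r%:R * (rho * m + r%:R * s)))%:E <=
   scaled_moment (T_law rho p) (rho * s) r <= (r`!%:R * (1 + rho * s) ^+ r)%:E)%E.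
Proof.
move=> r0; have /andP[th0 th1] := scale_in01.
have mle := moment_le _ _ _ _ _ rho01 c_ge0 G_ge0 G0 renewal a_cvg s_of_gt0 r.
have u0 t : 0 <= T_law rho p t * (rho * s * t%:R) ^+ r.
  by rewrite mulr_ge0 ?T_law_ge0 // exprn_ge0 // mulr_ge0 // ltW.
rewrite -T_lawE in mle.
have [l El ul] := bounded_nneseries u0 mle.
rewrite /scaled_moment El !lee_fin; apply/andP; split; last exact: cvg_ub_le ul.
apply: (moment_ge _ _ _ _ _ _ rho01 c_ge0 c0 c_sum G_ge0 G0 renewal
  a_cvg ta_cvg s_of_gt0) => // N; rewrite -T_lawE.
exact: (le_cvg_sum u0 ul).
Qed.

End ResetCollector.

(** * Passage to the limit by squeezing *)

Theorem mainTheorem2 (R : realType) (rho : nat -> R) (p : forall n : nat, 'I_n -> R)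
  (hrho : forall n : nat, (0 < n)%N -> 0 < rho n < 1)
  (hp : forall n : nat, (0 < n)%N -> forall i : 'I_n, 0 < p n i)
  (hsum : forall n : nat, (0 < n)%N -> \sum_(i < n) p n i = 1 - rho n)
  (hs : (fun n => s_of (rho n) (p n)) @ \oo --> (0 : R))
  (hd : (fun n => rho n * (1 - rho n) *
                  dpgf (C_law (coupon_pi (rho n) (p n))) (1 - rho n)) @ \oo --> (0 : R)) :
  (forall x : R,
     (fun n => scaled_cdf (T_law (rho n) (p n)) (rho n * s_of (rho n) (p n)) x)
       @ \oo --> exp1_cdf x)
  /\
  (forall r : nat, (0 < r)%N ->
     (fun n => scaled_moment (T_law (rho n) (p n)) (rho n * s_of (rho n) (p n)) r)
       @ \oo --> ((r`!)%:R : R)%:E).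
Proof.
pose s n := s_of (rho n) (p n).
pose rm n := rho n * ((1 - rho n) * dpgf (C_law (coupon_pi (rho n) (p n))) (1 - rho n)).
have hrm : rm @ \oo --> (0 : R).
  by rewrite /rm; under eq_fun => n do rewrite mulrA.
(* [0 <= rho n * s n <= s n] once [n > 0]. *)
have hth : (fun n => rho n * s n) @ \oo --> (0 : R).
  apply: (squeeze_cvgr _ (cvg_cst (0 : R)) hs); near=> n.
  have n0 : (0 < n)%N by near: n; apply: nbhs_infty_gt.
  have /andP[r0 r1] := hrho n n0.
  have s0 := s_of_gt0 _ _ _ _ (hrho n n0) (hp n n0) (hsum n n0).
  by rewrite mulr_ge0 ?(ltW r0) ?(ltW s0) //= ler_piMl // ltW.
have herr : (fun n => s n + rm n) @ \oo --> (0 : R).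
  by have := cvgD hs hrm; rewrite addr0; exact.
split=> [x|r r0].
- case: (ltP x 0) => x0.
    rewrite /exp1_cdf leNgt x0 /=; apply: cvg_near_cst; near=> n.
    have n0 : (0 < n)%N by near: n; apply: nbhs_infty_gt.
    have /andP[th0 _] := scale_in01 _ _ _ _ (hrho n n0) (hp n n0) (hsum n n0).
    exact: scaled_cdf_lt0.
  rewrite /exp1_cdf x0.
  have lo : (fun n => 1 - expR (rho n * s n - x) - (s n + rm n)) @ \oo -->
      (1 - expR (- x) : R).
    rewrite -[1 - expR (- x)]subr0; apply: cvgB herr.
    apply: cvgB; first exact: cvg_cst.
    apply: (continuous_cvg _ (@continuous_expR R _)).
    by have := cvgB hth (cvg_cst x); rewrite sub0r; exact.
  have up : (fun n => 1 - expR (- (x / (1 - rho n * s n))) + (s n + rm n)) @ \oo -->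
      (1 - expR (- x) : R).
    rewrite -[1 - expR (- x)]addr0; apply: cvgD herr.
    apply: cvgB; first exact: cvg_cst.
    apply: (continuous_cvg _ (@continuous_expR R _)); apply: cvgN.
    have : (fun n => x / (1 - rho n * s n)) @ \oo --> x / (1 - 0).
      apply: cvgMr; apply: cvgV; first by rewrite subr0 oner_neq0.
      by apply: cvgB hth; apply: cvg_cst.
    by rewrite subr0 divr1.
  apply: (squeeze_cvgr _ lo up); near=> n.
  have n0 : (0 < n)%N by near: n; apply: nbhs_infty_gt.
  exact: (scaled_cdf_T_law_bounds _ _ _ _ n0 (hrho n n0) (hp n n0) (hsum n n0)).
(* Both moment bounds are continuous in the vanishing quantities [rm n], [s n] and [rho n * s n],
   with value [r!] at 0. *)
have lo : (fun n => r`!%:R * (1 - r%:R * (rm n + r%:R * s n))) @ \oo --> (r`!%:R : R).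
  have : (fun n => r`!%:R * (1 - r%:R * (rm n + r%:R * s n))) @ \oo -->
      (r`!%:R * (1 - r%:R * (0 + r%:R * 0)) : R).
    apply: cvgMr; apply: cvgB; first exact: cvg_cst.
    by apply: cvgMr; apply: cvgD hrm _; apply: cvgMr.
  by rewrite mulr0 addr0 mulr0 subr0 mulr1.
have up : (fun n => r`!%:R * (1 + rho n * s n) ^+ r) @ \oo --> (r`!%:R : R).
  have : (fun n => r`!%:R * (1 + rho n * s n) ^+ r) @ \oo --> (r`!%:R * (1 + 0) ^+ r : R).
    apply: cvgMr; apply: (continuous_cvg _ (@exprn_continuous R r _)).
    by apply: cvgD hth; apply: cvg_cst.
  by rewrite addr0 expr1n mulr1.
have loE : (fun n => (r`!%:R * (1 - r%:R * (rm n + r%:R * s n)))%:E) @ \oo -->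
    (r`!%:R : R)%:E by apply: cvg_EFin lo; apply: nearW.
have upE : (fun n => (r`!%:R * (1 + rho n * s n) ^+ r)%:E) @ \oo --> (r`!%:R : R)%:E.
  by apply: cvg_EFin up; apply: nearW.
apply: (squeeze_cvge _ loE upE); near=> n.
have n0 : (0 < n)%N by near: n; apply: nbhs_infty_gt.
exact: (scaled_moment_T_law_bounds _ _ _ _ n0 (hrho n n0) (hp n n0) (hsum n n0)).
Unshelve. all: by end_near.
Qed.
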